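(* Let $d$ be a natural number and $\varepsilon, \alpha$ positive real numbers. Let $H$ be a bipartite graph on $n$ vertices with a vertex partition $W_1 \cup W_2$ into independent sets where every vertex in $W_1$ has at most $d$ neighbors in $W_2$. Let $G$ be a bipartite graph with vertex partition $V_1 \cup V_2$ (into independent sets) of density at least $\alpha$, where $|V_1| \ge (1+\varepsilon)\alpha^{-d} |W_1|$ and $|V_2| \ge \left(\frac{1+\varepsilon}{\varepsilon}\right)^{1/d}\alpha^{-2}|W_2|$. If $\frac{|W_2|^d}{|W_2|(|W_2|-1)\cdots(|W_2|-d+1)} \le 1 + \varepsilon$, then $G$ contains a copy of $H$.
   Context: For a bipartite graph with parts $V_1, V_2$, density means $\frac{e(V_1,V_2)}{|V_1||V_2|}$, where $e(V_1,V_2)$ is the number of edges. ''Contains a copy of $H$'' means has a (not necessarily induced) subgraph isomorphic to $H$. *)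

(* Defs.v *)
From HB Require Import structures.
From mathcomp Require Import all_boot all_order all_algebra.
From mathcomp Require Import all_classical all_reals all_analysis.

Set Implicit Arguments.
Unset Strict Implicit.
Unset Printing Implicit Defensive.

Import Order.TTheory GRing.Theory Num.Theory.
Local Open Scope ring_scope.

Record sgraph := SGraph {
  vertex :> finType;
  adj : rel vertex;
  adj_sym : symmetric adj;
  adj_irrefl : irreflexive adj
}.

Definition isomorphic (G K : sgraph) : Prop :=
  exists2 f : G -> K, bijective f & forall x y : G, adj (f x) (f y) = adj x y.

(* Not necessarily induced: the edges are any symmetric subset of the edges
   of G with both endpoints among the chosen vertices. *)
Record subgraph (G : sgraph) := Subgraph {
  sub_verts : {set G};
  sub_adj : rel G;
  sub_adj_sym : symmetric sub_adj;
  sub_adjP : forall x y : G, sub_adj x y ->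
    [/\ x \in sub_verts, y \in sub_verts & adj x y]
}.

Section SubgraphAsGraph.
Variables (G : sgraph) (S : subgraph G).

Definition graph_of_subgraph_adj : rel {x : G | x \in sub_verts S} :=
  fun x y => sub_adj S (val x) (val y).

Lemma graph_of_subgraph_adj_sym : symmetric graph_of_subgraph_adj.
Proof. by move=> x y; apply: sub_adj_sym. Qed.

Lemma graph_of_subgraph_adj_irrefl : irreflexive graph_of_subgraph_adj.
Proof.
by move=> x; apply/negP => /sub_adjP[_ _]; rewrite adj_irrefl.
Qed.

Definition graph_of_subgraph : sgraph :=
  SGraph graph_of_subgraph_adj_sym graph_of_subgraph_adj_irrefl.

End SubgraphAsGraph.

Definition contains_copy (G H : sgraph) : Prop :=
  exists S : subgraph G, isomorphic H (graph_of_subgraph S).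

Definition independent (G : sgraph) (A : {set G}) : Prop :=
  {in A &, forall x y : G, ~~ adj x y}.

(* The parts may be empty, so this is not finset's [partition]. *)
Definition bipartition (G : sgraph) (A B : {set G}) : Prop :=
  [/\ A :|: B = [set: G], [disjoint A & B], independent A & independent B].

(* Counts each edge once when A and B are disjoint. *)
Definition edges_between (G : sgraph) (A B : {set G}) : nat :=
  #|[set p : G * G | [&& p.1 \in A, p.2 \in B & adj p.1 p.2]]|.

Definition density (R : realType) (G : sgraph) (A B : {set G}) : R :=
  (edges_between A B)%:R / (#|A|%:R * #|B|%:R).

Definition nb_neighbors_in (G : sgraph) (A : {set G}) (x : G) : nat :=
  #|[set y in A | adj x y]|.

(* Main.v *)
Require Import Defs.
From HB Require Import structures.
From mathcomp Require Import all_boot all_order all_algebra.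
From mathcomp Require Import perm ring lra.
From mathcomp Require Import all_classical all_reals all_analysis.

Set Implicit Arguments.
Unset Strict Implicit.
Unset Printing Implicit Defensive.

Import Order.TTheory GRing.Theory Num.Theory.
Local Open Scope ring_scope.

(** Dependent random choice with a weighted count. Give a [d]-subset [S] of [V2]
    with common neighbourhood [N(S)] in [V1] the weight [1 / |N(S)|]. Summed over
    [x] in [V1], the total weight of the [d]-subsets of the neighbourhood [A_x]
    of [x] is at most [C(|V2|, d)], while convexity bounds the number of
    [d]-subsets of the neighbourhoods with [|A_x| >= |W2|] from below. Hence for
    some such [x] the average weight of a [d]-subset of [A_x] is at most
    [1 / |W1|], and a suitable injection of [W2] into [A_x] gives the images of
    the neighbourhoods of the vertices of [W1] total weight at most 1. When
    [sum_i 1 / c_i <= 1], the i-th smallest [c_i] is at least i, so the vertices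
    of [W1] can then be embedded greedily. *)

(** * Systems of distinct representatives *)

Lemma distinct_representatives (R : realFieldType) (T U : finType) (u0 : U)
    (C : T -> {set U}) (B : {set T}) :
    (forall w, w \in B -> (0 < #|C w|)%N) ->
    \sum_(w in B) (#|C w|%:R^-1 : R) <= 1 ->
  exists2 g : T -> U, {in B &, injective g} & {in B, forall w, g w \in C w}.
Proof.
have [n] := ubnP #|B|; elim: n B => // n IHn B ltBn C_gt0 sumC.
have [->|[w0 w0B]] := set_0Vmem B.
  by exists (fun=> u0) => ? ; rewrite ?inE.
(* A set of maximal size has at least [#|B|] elements, so it can be served last. *)
case: (@arg_maxnP _ w0 (mem B) (fun w => #|C w|) w0B) => w /= wB w_max; have {}wB : w \in B by [].
have ltB'n : (#|B :\ w| < n)%N by move: ltBn; rewrite (cardsD1 w) wB.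
have [||g g_inj gC] := IHn (B :\ w) ltB'n.
- by move=> v /setD1P[_]; apply: C_gt0.
- apply: le_trans sumC; rewrite [leRHS](big_setD1 w) //= lerDr.
  by rewrite invr_ge0.
(* Each of the [#|B|] terms is at least [1 / #|C w|], so the sum bound gives
   [#|B| / #|C w| <= 1]. *)
have leBC : (#|B| <= #|C w|)%N.
  rewrite -(ler_nat R) -[leRHS]mul1r -ler_pdivrMr ?ltr0n ?C_gt0 //.
  apply: le_trans sumC; rewrite mulr_natl -sumr_const.
  apply: ler_sum => v vB; rewrite lef_pV2 ?posrE ?ltr0n ?C_gt0 // ler_nat.
  exact: w_max.
have [u uC ug] : exists2 u, u \in C w & u \notin g @: (B :\ w).
  apply/fintype.subsetPn; apply: contraTN leBC => /subset_leq_card le_img.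
  rewrite -ltnNge (cardsD1 w) wB ltnS.
  exact: leq_trans le_img (leq_imset_card _ _).
have gNu v : v \in B -> v != w -> g v != u.
  move=> vB vw; apply: contraNneq ug => <-.
  by apply: imset_f; rewrite !inE vw.
exists (fun v => if v == w then u else g v) => [v1 v2 v1B v2B|v vB] /=.
  case: eqVneq => [->|v1w]; case: eqVneq => [->|v2w] //.
  - by move/esym/eqP; rewrite (negPf (gNu _ v2B v2w)).
  - by move/eqP; rewrite (negPf (gNu _ v1B v1w)).
  - by apply: g_inj; rewrite !inE ?v1w ?v2w.
by case: eqVneq => [->|vw] //; apply: gC; rewrite !inE vw.
Qed.

(** * Averaging over permutations *)

(** List [A] with [S1] first, and again with [S2] first; matching the two lists position by position
    gives the permutation. *)
Lemma perm_subset_transitive (T : finType) (A S1 S2 : {set T}) :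
    S1 \subset A -> S2 \subset A -> #|S1| = #|S2| ->
  exists2 s : {perm T}, s @: A = A & s @: S1 = S2.
Proof.
move=> sS1A sS2A eqS.
pose l (S : {set T}) := enum S ++ enum (A :\: S).
have memT (S : {set T}) : S \subset A -> l S =i A.
  move=> sSA x; rewrite mem_cat !mem_enum inE.
  by case: (boolP (x \in S)) => // /(fintype.subsetP sSA).
have uniqT (S : {set T}) : uniq (l S).
  rewrite cat_uniq !enum_uniq andbT /=; apply/hasPn => x.
  by rewrite !mem_enum inE => /andP[].
have sizeT (S : {set T}) : S \subset A -> size (l S) = #|A|.
  by move=> sSA; rewrite -(card_uniqP (uniqT S)); apply: eq_card; apply: memT.
(* The default [x] of [nth] makes [f] the identity outside [A]. *)
pose f x := nth x (l S2) (index x (l S1)).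
have sizeE : size (l S1) = size (l S2) by rewrite !sizeT.
have fA x : x \in A -> f x \in A.
  move=> xA; rewrite -(memT S2) // mem_nth // -sizeE index_mem.
  by rewrite memT.
have f_out x : x \notin A -> f x = x.
  by move=> xA; rewrite /f nth_default // -sizeE leqNgt index_mem memT.
have f_inj : injective f.
  move=> x y; case: (boolP (x \in A)) => xA; case: (boolP (y \in A)) => yA.
  - have lx : (index x (l S1) < size (l S2))%N by rewrite -sizeE index_mem memT.
    have ly : (index y (l S1) < size (l S2))%N by rewrite -sizeE index_mem memT.
    rewrite /f (set_nth_default x y) // => /eqP; rewrite nth_uniq // => /eqP.
    by apply: (index_inj x); rewrite memT.
  - by rewrite (f_out y) // => fxy; move: (fA x xA); rewrite fxy (negPf yA).
  - by rewrite (f_out x) // => fxy; move: (fA y yA); rewrite -fxy (negPf xA).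
  - by rewrite !f_out.
exists (perm f_inj).
  apply/eqP; rewrite eqEcard card_imset ?leqnn ?andbT; last exact: perm_inj.
  by apply/fintype.subsetP => _ /imsetP[x xA ->]; rewrite permE fA.
apply/eqP; rewrite eqEcard card_imset ?eqS ?leqnn ?andbT; last exact: perm_inj.
apply/fintype.subsetP => _ /imsetP[x xS ->]; rewrite permE /f.
have lx : (index x (enum S1) < size (enum S2))%N.
  by rewrite -cardE -eqS cardE index_mem mem_enum.
by rewrite index_cat mem_enum xS nth_cat lx -mem_enum mem_nth.
Qed.

(** A uniformly random permutation preserving [A] sends each [E w] to a uniformly random [d]-subset
    of [A]. Hence equality holds on average, and some permutation does no worse. *)
Lemma perm_average_le (R : realFieldType) (T I : finType) (A : {set T}) (d : nat)
    (g : {set T} -> R) (B : {set I}) (E : I -> {set T}) :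
    (forall w, w \in B -> E w \subset A /\ #|E w| = d) ->
  exists2 s : {perm T}, s @: A = A &
    'C(#|A|, d)%:R * \sum_(w in B) g (s @: E w)
      <= #|B|%:R * \sum_(S : {set T} | (S \subset A) && (#|S| == d)) g S.
Proof.
move=> hE.
pose P (s : {perm T}) := s @: A == A.
pose Q (S : {set T}) := (S \subset A) && (#|S| == d).
pose K (S : {set T}) := \sum_(s | P s) g (s @: S).
have mulI (s t : {perm T}) (S : {set T}) : (s * t)%g @: S = t @: (s @: S).
  by rewrite -imset_comp; apply: eq_imset => x; rewrite permM.
have K_const S1 S2 : Q S1 -> Q S2 -> K S1 = K S2.
  move=> /andP[s1A /eqP c1] /andP[s2A /eqP c2].
  have [t tA <-] := perm_subset_transitive s1A s2A (etrans c1 (esym c2)).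
  rewrite /K (reindex_inj (mulgI t)) /=; apply: eq_big => [s|s _].
    by rewrite /P mulI tA.
  by rewrite mulI.
have sumK : \sum_(S | Q S) K S = \sum_(s | P s) \sum_(S | Q S) g S.
  rewrite exchange_big /=; apply: eq_bigr => s /eqP sA.
  rewrite [RHS](reindex_inj (imset_inj (@perm_inj _ s))) /=.
  apply: eq_bigl => S; rewrite /Q card_imset; last exact: perm_inj.
  congr (_ && _); rewrite -[in RHS]sA; apply/idP/idP; first exact: imsetS.
  move/fintype.subsetP=> sS; apply/fintype.subsetP => x xS.
  by have /imsetP[y yA /perm_inj ->] := sS _ (imset_f s xS).
have cardQ : #|[pred S | Q S]| = 'C(#|A|, d).
  by rewrite -cards_draws cardsE; apply: eq_card.
have KE S : Q S -> 'C(#|A|, d)%:R * K S = \sum_(s | P s) \sum_(S | Q S) g S.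
  move=> QS; rewrite -sumK (eq_bigr (fun=> K S)) => [|S' QS']; last exact: K_const.
  by rewrite sumr_const cardQ mulr_natl.
have P1 : P 1%g.
  by rewrite /P (eq_imset (g := id)) ?imset_id // => x; rewrite perm1.
apply: contrapT => no_s.
have : \sum_(s | P s) ('C(#|A|, d)%:R * \sum_(w in B) g (s @: E w))
   > \sum_(s | P s) (#|B|%:R * \sum_(S | Q S) g S).
  apply: ltr_sum; first by apply/hasP; exists 1%g; rewrite ?mem_index_enum.
  move=> s /eqP sA; rewrite ltNge; apply/negP => le_s.
  by apply: no_s; exists s.
rewrite -!mulr_sumr [X in _ < _ * X]exchange_big /= [ltRHS]mulr_sumr.
rewrite [ltRHS](eq_bigr (fun=> \sum_(s | P s) \sum_(S | Q S) g S)); last first.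
  by move=> w /hE[sw cw]; apply: KE; rewrite /Q sw cw eqxx.
by rewrite [ltRHS]sumr_const mulr_natl ltxx.
Qed.

(** * Estimates for falling factorials *)

(** A supporting line at [mu]: the product is convex from [d - 1] onwards, and the [L] constructed
    is its derivative at [mu]. *)
Lemma falling_prod_support (R : realFieldType) (d : nat) (mu : R) :
    (d.-1)%:R <= mu ->
  exists2 L : R, 0 <= L & forall z, (d.-1)%:R <= z ->
    \prod_(i < d) (mu - i%:R) + L * (z - mu) <= \prod_(i < d) (z - i%:R).
Proof.
elim: d => [|d IHd] /= mu_ge.
  by exists 0 => // z _; rewrite !big_ord0 mul0r addr0.
have ltd z : d%:R <= z -> (d.-1)%:R <= z :> R.
  by apply: le_trans; rewrite ler_nat leq_pred.
have [L L_ge0 hL] := IHd (ltd _ mu_ge).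
have f_ge0 : 0 <= \prod_(i < d) (mu - i%:R).
  apply: prodr_ge0 => i _; rewrite subr_ge0; apply: le_trans mu_ge.
  by rewrite ler_nat ltnW.
set f := \prod_(i < d) (mu - i%:R) in hL f_ge0 *.
(* Product rule for the derivative; the induction step then loses only [L * (z - mu) ^+ 2]. *)
exists (f + L * (mu - d%:R)) => [|z z_ge].
  by rewrite addr_ge0 // mulr_ge0 // subr_ge0.
rewrite !big_ord_recr /= -/f.
apply: (le_trans _ (ler_wpM2r _ (hL z (ltd _ z_ge)))); last by rewrite subr_ge0.
rewrite -subr_ge0 (_ : _ - _ = L * (z - mu) ^+ 2); last by ring.
by rewrite mulr_ge0 // sqr_ge0.
Qed.

(* For an integer argument the product is the falling factorial, both for
   [d <= a] and for [a < d], where a factor vanishes. *)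
Lemma ffact_prodE (R : realFieldType) (a d : nat) :
  (a ^_ d)%:R = \prod_(i < d) (a%:R - i%:R) :> R.
Proof.
elim: d => [|d IHd]; first by rewrite ffactn0 big_ord0.
rewrite ffactnSr natrM IHd big_ord_recr /=.
have [le_da|lt_ad] := leqP d a; first by rewrite natrB.
rewrite (eqP (ltnW lt_ad : (a - d == 0)%N)) mulr0.
by rewrite -IHd ffact_small // mul0r.
Qed.

(* With [s i = i / M] and [be = M / (al * N)], the products are the falling
   factorials of [M], [N] and [al * N], divided by their leading powers. *)
Lemma prod_three_le (R : realFieldType) (d : nat) (s : nat -> R) (al be : R) :
    0 <= al <= 1 -> 0 <= be <= 1 -> (forall i, (i < d)%N -> 0 <= s i <= 1) ->
  let p := \prod_(i < d) (1 - s i) in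
  let q := \prod_(i < d) (1 - al * be * s i) in
  [/\ 0 <= p, p <= 1, p <= q &
      p * (q + al ^+ d * (1 - p)) <= \prod_(i < d) (1 - be * s i)].
Proof.
move=> /andP[al0 al1] /andP[be0 be1].
elim: d => [|d IHd] hs /=; first by rewrite !big_ord0; split; lra.
have [|p0 p1 pq IH] := IHd; first by move=> i lid; apply/hs/ltnW.
rewrite !big_ord_recr /=; have /andP[s0 s1] := hs d (ltnSn d).
set p := \prod_(i < d) _ in p0 p1 pq IH *.
set q := \prod_(i < d) (1 - al * _ * _) in pq IH *.
set P := \prod_(i < d) _ in IH *.
move: (s d) s0 s1 => t t0 t1.
have ab0 : 0 <= al * be by rewrite mulr_ge0.
have ab1 : al * be <= 1 by rewrite mulr_ile1.
have abt : al * be * t <= t by rewrite ler_piMl.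
have bt : be * t <= t by rewrite ler_piMl.
have q0 : 0 <= q := le_trans p0 pq.
have t1' : 0 <= 1 - t by rewrite subr_ge0.
split.
- by rewrite mulr_ge0.
- by apply: mulr_ile1 => //; lra.
- by apply: ler_pM => //; lra.
have bt1 : 0 <= 1 - be * t by lra.
apply: (le_trans _ (ler_wpM2r bt1 IH)).
rewrite -!mulrA; apply: ler_wpM2l => //.
rewrite exprS; set A := al ^+ d.
have A0 : 0 <= A by rewrite exprn_ge0.
have A1 : A <= 1 by rewrite exprn_ile1.
(* Split [1 - p * (1 - t)] as [(1 - p) + p * t]. The first part is handled by [h3]; since
   [A * p <= q], the second is absorbed into the [q] term, where [factor] applies. *)
have factor : (1 - t) * (1 - al * be * t + al * t) <= 1 - be * t.
  rewrite -subr_ge0 (_ : _ - _ = t * (1 - be) * (1 - al + al * t)); last by ring.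
  have alt : 0 <= al * t by rewrite mulr_ge0.
  by do 2 ?apply: mulr_ge0 => //; lra.
have h1 := ler_wpM2r q0 factor.
have h2 : al * (1 - t) <= 1 - be * t.
  by apply: le_trans (_ : 1 - t <= _); [rewrite ler_piMl|lra].
have h3 : A * (1 - p) * (al * (1 - t)) <= A * (1 - p) * (1 - be * t).
  by apply: ler_wpM2l => //; rewrite mulr_ge0 // subr_ge0.
have h4 : (1 - t) * al * t * (A * p) <= (1 - t) * al * t * q.
  apply: ler_wpM2l; first by rewrite !mulr_ge0.
  by apply: le_trans pq; rewrite ler_piMl.
nra.
Qed.

(** The value at [al * N], a lower bound for the mean degree, has to pay both for the [d]-subsets of
    [V2] and for discarding the neighbourhoods smaller than [M]. After division by [(al * N) ^+ d]
    this reduces to [prod_three_le]. *)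
Lemma falling_prod_gap (R : realFieldType) (d : nat) (eps al M N : R) :
    0 < eps -> 0 < al <= 1 -> 0 < M -> d%:R <= M -> M <= al * N ->
    (M / (al ^+ 2 * N)) ^+ d <= eps / (1 + eps) ->
    M ^+ d <= (1 + eps) * \prod_(i < d) (M - i%:R) ->
  al ^+ d * \prod_(i < d) (N - i%:R) / (1 + eps) + \prod_(i < d) (M - i%:R)
    <= \prod_(i < d) (al * N - i%:R).
Proof.
move=> eps0 /andP[al0 al1] M0 dM MN tN ratio.
have aN0 : 0 < al * N by apply: lt_le_trans MN.
have N0 : 0 < N by move: aN0; rewrite pmulr_rgt0.
pose s (i : nat) := i%:R / M.
pose be := M / (al * N).
have be01 : 0 <= be <= 1.
  apply/andP; split; first by apply: divr_ge0; apply: ltW.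
  by rewrite ler_pdivrMr // mul1r.
have s01 i : (i < d)%N -> 0 <= s i <= 1.
  move=> lid; apply/andP; split; first by rewrite divr_ge0 // ltW.
  rewrite ler_pdivrMr // mul1r.
  by apply: le_trans dM; rewrite ler_nat ltnW.
have al01 : 0 <= al <= 1 by rewrite al1 ltW.
have prodE (x z : R) : x != 0 -> (forall i : nat, z * s i = i%:R / x) ->
    \prod_(i < d) (x - i%:R) = x ^+ d * \prod_(i < d) (1 - z * s i).
  move=> x0 hz; rewrite -[X in x ^+ X](card_ord d) -prodr_const -big_split /=.
  by apply: eq_bigr => i _; rewrite hz mulrBr mulr1 mulrC divfK.
have [p0 p1 pq key] := prod_three_le al01 be01 s01.
rewrite (prodE (al * N) be) ?gt_eqF // => [|i]; last first.
  by rewrite /be /s; field; rewrite ?gt_eqF.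
rewrite (prodE N (al * be)) ?gt_eqF // => [|i]; last first.
  by rewrite /be /s; field; rewrite ?gt_eqF.
have pE : \prod_(i < d) (M - i%:R) = M ^+ d * \prod_(i < d) (1 - s i).
  rewrite (prodE M 1) ?gt_eqF // => [|i]; last by rewrite mul1r.
  by congr (_ * _); apply: eq_bigr => i _; rewrite mul1r.
rewrite pE in ratio *.
set p := \prod_(i < d) (1 - s i) in p0 p1 pq key ratio *.
set q := \prod_(i < d) (1 - al * be * s i) in pq key *.
set P := \prod_(i < d) (1 - be * s i) in key *.
pose u := (1 + eps)^-1.
have e1 : 0 < 1 + eps by lra.
have up : u <= p.
  rewrite /u -[_^-1]mul1r ler_pdivrMr // mulrC.
  by move: ratio; rewrite mulrCA -[leLHS]mulr1 ler_pM2l ?exprn_gt0.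
have u1 : eps / (1 + eps) = 1 - u by rewrite /u; field; rewrite gt_eqF.
rewrite u1 in tN.
have bed : be ^+ d <= al ^+ d * (1 - u).
  have -> : be = al * (M / (al ^+ 2 * N)).
    by rewrite /be; field; rewrite ?gt_eqF.
  by rewrite exprMn ler_pM2l ?exprn_gt0.
have -> : M ^+ d = (al * N) ^+ d * be ^+ d.
  by rewrite -exprMn /be mulrC divfK ?gt_eqF.
rewrite exprMn -/u.
have -> : al ^+ d * (N ^+ d * q) * u + al ^+ d * N ^+ d * be ^+ d * p
        = (al ^+ d * N ^+ d) * (u * q + be ^+ d * p) by ring.
rewrite ler_pM2l ?mulr_gt0 ?exprn_gt0 //.
apply: le_trans key.
have A0 : 0 <= al ^+ d by rewrite exprn_ge0 // ltW.
have A1 : al ^+ d <= 1 by rewrite exprn_ile1 // ltW.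
have h1 : be ^+ d * p <= al ^+ d * (1 - u) * p by apply: ler_wpM2r.
have Apq : al ^+ d * p <= q by apply: le_trans pq; rewrite ler_piMl.
(* This product is exactly the left side of [key] minus [u * q + al ^+ d * (1 - u) * p]. *)
have h2 : 0 <= (p - u) * (q - al ^+ d * p) by rewrite mulr_ge0 ?subr_ge0.
move: h1 h2; move: (be ^+ d * p) (al ^+ d) => X A; nra.
Qed.

(** * Copies from adjacency-preserving injections *)

Lemma contains_copy_of_injection (G H : sgraph) (h : H -> G) :
    injective h -> (forall x y, adj x y -> adj (h x) (h y)) -> contains_copy G H.
Proof.
move=> h_inj h_adj.
(* Only the images of edges of [H] are kept, because [h] need not reflect adjacency in [G]. *)
pose sadj : rel G := fun x y =>
  [exists a, exists b, [&& h a == x, h b == y & adj a b]].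
have sadj_sym : symmetric sadj.
  move=> x y; apply/idP/idP => /existsP[a /existsP[b /and3P[ha hb ab]]];
    by apply/existsP; exists b; apply/existsP; exists a; rewrite ha hb adj_sym.
have sadjP x y : sadj x y ->
    [/\ x \in h @: [set: H], y \in h @: [set: H] & adj x y].
  move=> /existsP[a /existsP[b /and3P[/eqP<- /eqP<- ab]]].
  by split; rewrite ?imset_f ?inE ?h_adj.
have hV a : h a \in sub_verts (Subgraph sadj_sym sadjP) by rewrite imset_f ?inE.
exists (Subgraph sadj_sym sadjP).
exists (fun a => exist _ (h a) (hV a)).
  apply: inj_card_bij => [a b /(congr1 val) /h_inj //|].
  by rewrite /= card_sig -(cardsT H) -(card_imset _ h_inj) leq_eqVlt; apply/orP;
    left; apply/eqP/eq_card.
move=> x y; rewrite /= /graph_of_subgraph_adj /=.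
apply/idP/idP => [/existsP[a /existsP[b /and3P[/eqP/h_inj<- /eqP/h_inj<- //]]]|xy].
by apply/existsP; exists x; apply/existsP; exists y; rewrite !eqxx.
Qed.

(** * Dependent random choice *)

Section DependentRandomChoice.
Variables (G : sgraph) (V1 V2 : {set G}).

Definition nbhd (x : G) : {set G} := [set y in V2 | adj x y].
Definition common_nbhd (S : {set G}) : {set G} :=
  [set v in V1 | S \subset nbhd v].

Lemma sum_card_nbhd : \sum_(x in V1) #|nbhd x| = edges_between V1 V2.
Proof.
rewrite /edges_between -sum1_card.
rewrite (eq_bigr (fun x => \sum_(y in nbhd x) 1%N)) => [|x _]; last first.
  by rewrite sum1_card.
rewrite pair_big_dep /=; apply: eq_bigl => -[x y] /=.
by rewrite !inE /=.
Qed.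

Lemma edges_between_le : (edges_between V1 V2 <= #|V1| * #|V2|)%N.
Proof.
rewrite -cardsX; apply/subset_leq_card/fintype.subsetP => -[x y].
by rewrite !inE /= => /and3P[-> -> _].
Qed.

(* The weight [1 / #|common_nbhd S|] is counted once for each vertex of
   [common_nbhd S], so every [S] contributes at most 1. *)
Lemma sum_weight_le (R : realFieldType) (d : nat) :
  \sum_(x in V1)
      \sum_(S : {set G} | (S \subset nbhd x) && (#|S| == d))
         (#|common_nbhd S|%:R^-1 : R)
    <= 'C(#|V2|, d)%:R.
Proof.
rewrite (exchange_big_dep
  (fun S : {set G} => (S \subset V2) && (#|S| == d))) /=; last first.
  move=> x S _ /andP[sS ->]; rewrite andbT; apply: fintype.subset_trans sS _.
  by apply/fintype.subsetP => y; rewrite inE => /andP[].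
rewrite -cards_draws -sum1_card natr_sum big_mkcond [leRHS]big_mkcond /=.
apply: ler_sum => S _; rewrite inE; case: ifP => // /andP[_ cS].
rewrite (eq_bigl (fun x => x \in common_nbhd S)) => [|x]; last first.
  by rewrite !inE cS andbT.
rewrite sumr_const -[leLHS]mulr_natl.
have [->|n0] := eqVneq #|common_nbhd S| 0%N; first by rewrite mul0r.
by rewrite divff // pnatr_eq0.
Qed.

(** If the inequality failed at every neighbourhood with at least [M] elements, summing over [V1]
    would contradict [sum_Y] and [sum_phi]. *)
Lemma exists_rich_nbhd (R : realFieldType) (d M : nat) (w al eps : R) :
    (0 < d)%N -> (d <= M)%N -> 0 < eps -> 0 < al <= 1 -> 0 <= w ->
    al * (#|V1|%:R * #|V2|%:R) <= (edges_between V1 V2)%:R ->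
    (0 < #|V1|)%N ->
    (1 + eps) * w <= al ^+ d * #|V1|%:R ->
    M%:R <= al * #|V2|%:R ->
    (M%:R / (al ^+ 2 * #|V2|%:R)) ^+ d <= eps / (1 + eps) ->
    M%:R ^+ d <= (1 + eps) * (M ^_ d)%:R ->
  exists x, [/\ x \in V1, (M <= #|nbhd x|)%N &
    w * \sum_(S : {set G} | (S \subset nbhd x) && (#|S| == d))
          #|common_nbhd S|%:R^-1 <= 'C(#|nbhd x|, d)%:R].
Proof.
move=> d0 dM eps0 al01 w0 dens V10 wV1 MV2 tN ratio.
set Y := fun x => \sum_(S : {set G} | (S \subset nbhd x) && (#|S| == d))
          (#|common_nbhd S|%:R^-1 : R).
have M0 : (0 < M)%N := leq_trans d0 dM.
set mu := al * #|V2|%:R in MV2.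
have dmu : (d.-1)%:R <= mu.
  by apply: le_trans MV2; rewrite ler_nat (leq_trans (leq_pred _)).
have [L L0 hL] := falling_prod_support dmu.
set Pmu := \prod_(i < d) (mu - i%:R) in hL.
have gap : al ^+ d * (#|V2| ^_ d)%:R / (1 + eps) + (M ^_ d)%:R <= Pmu.
  rewrite !ffact_prodE; apply: falling_prod_gap => //.
  - by rewrite ltr0n.
  - by rewrite ler_nat.
  - by rewrite -ffact_prodE.
pose phi x : R := if (M <= #|nbhd x|)%N then (#|nbhd x| ^_ d)%:R else 0.
(* For a neighbourhood smaller than [M], the supporting line lies below its value at [M], hence
   below [M ^_ d], so the left side is at most 0. *)
have phi_ge x : Pmu - (M ^_ d)%:R + L * (#|nbhd x|%:R - mu) <= phi x.
  rewrite /phi; case: leqP => [leM|ltM].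
    have := hL #|nbhd x|%:R; rewrite -ffact_prodE ler_nat.
    have -> : (d.-1 <= #|nbhd x|)%N.
      exact: leq_trans (leq_pred _) (leq_trans dM leM).
    have := ler0n R (M ^_ d); move=> h /(_ isT); lra.
  have := hL M%:R; rewrite -ffact_prodE ler_nat (leq_trans (leq_pred _) dM).
  move=> /(_ isT).
  have : L * (#|nbhd x|%:R - mu) <= L * (M%:R - mu).
    by apply: ler_wpM2l => //; rewrite lerD2r ler_nat ltnW.
  lra.
have sum_nb : (edges_between V1 V2)%:R = \sum_(x in V1) #|nbhd x|%:R :> R.
  by rewrite -sum_card_nbhd natr_sum.
have sum_mu : 0 <= \sum_(x in V1) (#|nbhd x|%:R - mu).
  rewrite sumrB -sum_nb sumr_const -[mu *+ _]mulr_natl subr_ge0.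
  by rewrite /mu mulrCA.
have sum_phi : #|V1|%:R * (Pmu - (M ^_ d)%:R) <= \sum_(x in V1) phi x.
  apply: (le_trans _ (ler_sum _ (fun x _ => phi_ge x))).
  rewrite big_split /= sumr_const mulr_natl lerDl -mulr_sumr.
  exact: mulr_ge0.
have Y0 x : 0 <= Y x by apply: sumr_ge0 => S _; rewrite invr_ge0.
have sum_Y : w * d`!%:R * \sum_(x in V1) Y x
             <= #|V1|%:R * (Pmu - (M ^_ d)%:R).
  apply: le_trans (_ : w * (#|V2| ^_ d)%:R <= _).
    rewrite -mulrA; apply: ler_wpM2l => //.
    by rewrite -bin_ffact mulnC natrM ler_wpM2l // sum_weight_le.
  have e1 : 0 < 1 + eps by lra.
  apply: le_trans (_ : #|V1|%:R * (al ^+ d * (#|V2| ^_ d)%:R / (1 + eps)) <= _).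
    rewrite (_ : #|V1|%:R * _ =
      (al ^+ d * #|V1|%:R / (1 + eps)) * (#|V2| ^_ d)%:R); last by ring.
    by apply: ler_wpM2r => //; rewrite ler_pdivlMr // mulrC.
  by apply: ler_wpM2l => //; lra.
(* Such a vertex makes the final comparison of sums strict. Without one, the mean would fall below
   [M <= mu]. *)
have [x0 x0V1 x0M] : exists2 x, x \in V1 & (M <= #|nbhd x|)%N.
  apply: contrapT => no_x.
  have : \sum_(x in V1) (#|nbhd x|%:R - mu) < \sum_(x in V1) 0.
    apply: ltr_sum => [|x xV1].
      have /card_gt0P[x xV1] := V10.
      by apply/hasP; exists x; rewrite ?mem_index_enum.
    rewrite subr_lt0; apply: lt_le_trans MV2; rewrite ltr_nat ltnNge.
    by apply/negP => leM; apply: no_x; exists x.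
  by rewrite [ltRHS]big1 // ltNge sum_mu.
apply: contrapT => no_x.
have : \sum_(x in V1) phi x
       < \sum_(x in V1) (w * d`!%:R * Y x).
  rewrite (bigD1 x0) //= [ltRHS](bigD1 x0) //=.
  have lt_phi x : x \in V1 -> (M <= #|nbhd x|)%N -> phi x < w * d`!%:R * Y x.
    move=> xV1 leM; rewrite /phi leM ltNge; apply/negP => le_x; apply: no_x.
    exists x; split=> //; rewrite -(ler_pM2r (_ : 0 < d`!%:R)) ?ltr0n ?fact_gt0 //.
    by rewrite -natrM bin_ffact mulrAC.
  apply: ltr_leD; first exact: lt_phi.
  apply: ler_sum => x /andP[xV1 _].
  have [/(lt_phi x xV1)/ltW //|ltM] := leqP M #|nbhd x|.
  by rewrite /phi leqNgt ltM /= !mulr_ge0.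
by rewrite -mulr_sumr ltNge (le_trans sum_Y sum_phi).
Qed.

End DependentRandomChoice.

(** * Choosing supersets and injections of finite sets *)

Lemma exists_superset_card (T : finType) (A B : {set T}) (d : nat) :
    A \subset B -> (#|A| <= d <= #|B|)%N ->
  exists2 D : {set T}, A \subset D & D \subset B /\ #|D| = d.
Proof.
move=> sAB /andP[]; elim: d => [|d IHd].
  rewrite leqn0 => /eqP A0 _; exists A => //.
rewrite leq_eqVlt => /orP[/eqP AE _|ltAd ltdB]; first by exists A.
have [D sAD [sDB cD]] := IHd ltAd (ltnW ltdB).
have [x xB xD] : exists2 x, x \in B & x \notin D.
  apply/subsetPn; apply: contraTN ltdB => /subset_leq_card.
  by rewrite cD -leqNgt.
exists (x |: D); first by apply: fintype.subset_trans sAD (finset.subsetUr _ _).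
by rewrite finset.subUset finset.sub1set xB sDB cardsU1 xD cD.
Qed.

Lemma exists_injection_into (T U : finType) (u0 : U) (A : {set T}) (B : {set U}) :
    (#|A| <= #|B|)%N ->
  exists2 f : T -> U, {in A &, injective f} & {in A, forall x, f x \in B}.
Proof.
move=> leAB; pose f x := nth u0 (enum B) (index x (enum A)).
have lt_index x : x \in A -> (index x (enum A) < size (enum B))%N.
  by move=> xA; rewrite -cardE (leq_trans _ leAB) // [#|A|]cardE index_mem mem_enum.
exists f => [x y xA yA|x xA]; last by rewrite -mem_enum mem_nth ?lt_index.
move/eqP; rewrite nth_uniq ?enum_uniq ?lt_index // => /eqP.
by apply: (index_inj x); rewrite mem_enum.
Qed.

(** * Assembling the embedding *)

Theorem theorem2p3 (R : realType) (d : nat) (eps alpha : R)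
  (d_gt0 : (0 < d)%N) (eps_gt0 : 0 < eps) (alpha_gt0 : 0 < alpha)
  (H : sgraph) (n : nat) (card_H : #|H| = n) (W1 W2 : {set H})
  (bip_H : bipartition W1 W2)
  (deg_W1 : forall w : H, w \in W1 -> (nb_neighbors_in W2 w <= d)%N)
  (G : sgraph) (V1 V2 : {set G})
  (bip_G : bipartition V1 V2)
  (dens_G : alpha <= density R V1 V2)
  (card_V1 : (1 + eps) * alpha ^- d * #|W1|%:R <= #|V1|%:R)
  (card_V2 : ((1 + eps) / eps) `^ (d%:R^-1) * alpha ^- 2 * #|W2|%:R
             <= #|V2|%:R)
  (d_le_W2 : (d <= #|W2|)%N)
  (ratio_W2 : #|W2|%:R ^+ d / (#|W2| ^_ d)%:R <= 1 + eps) :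
  contains_copy G H.
Proof.
have [WU Wdisj W1ind W2ind] := bip_H.
have [VU Vdisj _ _] := bip_G.
have e1 : 0 < 1 + eps by lra.
set M := #|W2| in card_V2 d_le_W2 ratio_W2.
have M0 : (0 < M)%N := leq_trans d_gt0 d_le_W2.
(* Division by 0 yields 0, so an empty part would give density 0, below [alpha]. *)
have V12_gt0 : (0 < #|V1| * #|V2|)%N.
  rewrite lt0n; apply: contraTneq dens_G => V0.
  by rewrite -ltNge /density -natrM V0 invr0 mulr0.
have /andP[V1_gt0 V2_gt0] : (0 < #|V1|)%N && (0 < #|V2|)%N by rewrite -muln_gt0.
have V2R : 0 < #|V2|%:R :> R by rewrite ltr0n.
have V12R : 0 < #|V1|%:R * #|V2|%:R :> R by rewrite -natrM ltr0n.
have edges_ge : alpha * (#|V1|%:R * #|V2|%:R) <= (edges_between V1 V2)%:R.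
  by rewrite -ler_pdivlMr.
have alpha_le1 : alpha <= 1.
  apply: le_trans dens_G _; rewrite /density ler_pdivrMr // mul1r -natrM.
  by rewrite ler_nat edges_between_le.
set c := _ `^ _ in card_V2.
have c_ge0 : 0 <= c by apply: powR_ge0.
have cd : c ^+ d = (1 + eps) / eps.
  rewrite -powR_mulrn // -powRrM mulVf ?pnatr_eq0 -?lt0n // powRr1 //.
  by apply: divr_ge0; apply: ltW.
have c_ge1 : 1 <= c.
  rewrite leNgt; apply/negP => c_lt1.
  have : c ^+ d <= 1 by rewrite exprn_ile1 // ltW.
  by rewrite cd ler_pdivrMr //; lra.
have cM : c * M%:R <= alpha ^+ 2 * #|V2|%:R.
  by move: card_V2; rewrite mulrAC ler_pdivrMr ?exprn_gt0 // [leRHS]mulrC.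
have a2V : 0 < alpha ^+ 2 * #|V2|%:R by rewrite mulr_gt0 ?exprn_gt0.
have MV2 : M%:R <= alpha * #|V2|%:R.
  apply: le_trans (_ : c * M%:R <= _); first by rewrite ler_peMl.
  apply: le_trans cM _; rewrite ler_pM2r // expr2.
  by rewrite ler_piMl // ltW.
have tN : (M%:R / (alpha ^+ 2 * #|V2|%:R)) ^+ d <= eps / (1 + eps).
  have -> : eps / (1 + eps) = c^-1 ^+ d by rewrite exprVn cd invf_div.
  have c_gt0 : 0 < c by apply: lt_le_trans c_ge1.
  apply: lerXn2r; rewrite ?nnegrE ?invr_ge0 //.
    by apply: divr_ge0 => //; apply: ltW.
  by rewrite ler_pdivrMr // mulrC ler_pdivlMr // mulrC.
have ratio : M%:R ^+ d <= (1 + eps) * (M ^_ d)%:R.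
  by rewrite -ler_pdivrMr // ltr0n ffact_gt0.
have w_le : (1 + eps) * #|W1|%:R <= alpha ^+ d * #|V1|%:R.
  by move: card_V1; rewrite mulrAC ler_pdivrMr ?exprn_gt0 // [leRHS]mulrC.
have al01 : 0 < alpha <= 1 by rewrite alpha_gt0.
have [x [xV1 Mx wx]] := exists_rich_nbhd d_gt0 d_le_W2 eps_gt0 al01 (ler0n _ _)
  edges_ge V1_gt0 w_le MV2 tN ratio.
set A := nbhd V2 x in Mx wx.
have [f0 f0_inj f0A] := exists_injection_into x Mx.
(* Pad each neighbourhood to exactly [d] vertices of [W2], as the averaging requires; this can only
   shrink the common neighbourhoods. Outside [W1] the empty set is a dummy value. *)
have /choice[D hD] : forall w, exists D : {set H}, w \in W1 ->
    [/\ [set y in W2 | adj w y] \subset D, D \subset W2 & #|D| = d].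
  move=> w; case: (boolP (w \in W1)) => [wW1|_]; last by exists finset.set0.
  have [||D sD [DW2 cD]] :=
      @exists_superset_card _ [set y in W2 | adj w y] W2 d.
  - by apply/fintype.subsetP => y; rewrite inE => /andP[].
  - by rewrite d_le_W2 andbT; apply: deg_W1.
  - by exists D.
have f0D w : w \in W1 -> f0 @: D w \subset A /\ #|f0 @: D w| = d.
  move=> /hD[_ /fintype.subsetP DW2 cD]; split.
    by apply/fintype.subsetP => _ /imsetP[y yD ->]; apply/f0A/DW2.
  rewrite card_in_imset // => y z yD zD; apply: f0_inj; exact: DW2.
have [s sA hs] :=
  perm_average_le (fun S => (#|common_nbhd V1 V2 S|%:R^-1 : R)) f0D.
pose f y := s (f0 y).
have fE w : s @: (f0 @: D w) = f @: D w by rewrite -imset_comp.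
have fA : {in W2, forall y, f y \in A}.
  by move=> y yW; rewrite -sA; apply/imset_f/f0A.
have f_inj : {in W2 &, injective f}.
  by move=> y z yW zW /perm_inj; apply: f0_inj.
pose C w := common_nbhd V1 V2 (f @: D w).
(* [x] itself is a common neighbour. This has to be checked apart from [sumC], since an empty [C w]
   would have weight [0^-1 = 0]. *)
have C_gt0 w : w \in W1 -> (0 < #|C w|)%N.
  move=> /hD[_ /fintype.subsetP DW2 _]; apply/card_gt0P; exists x.
  rewrite inE xV1; apply/fintype.subsetP => _ /imsetP[y yD ->].
  exact/fA/DW2.
have sumC : \sum_(w in W1) (#|C w|%:R^-1 : R) <= 1.
  have binA : 0 < 'C(#|A|, d)%:R :> R.
    by rewrite ltr0n bin_gt0 (leq_trans d_le_W2).
  (* Chain the averaging bound [hs] with the choice of [x] in [wx]; both carry the factor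
     ['C(#|A|, d)]. *)
  rewrite -(ler_pM2l binA) mulr1; apply: le_trans wx.
  apply: le_trans hs; rewrite ler_pM2l //.
  by apply: ler_sum => w _; rewrite fE.
have [g g_inj gC] := distinct_representatives x C_gt0 sumC.
have gV1 w : w \in W1 -> g w \in V1.
  by move=> /gC; rewrite inE => /andP[].
have fV2 y : y \in W2 -> f y \in V2.
  by move=> /fA; rewrite inE => /andP[].
have W2E y : y \notin W1 -> y \in W2.
  by move=> yW1; have := finset.in_setT y; rewrite -WU inE (negPf yW1).
have VN v : v \in V1 -> v \in V2 -> false.
  by move=> v1 v2; rewrite (disjointFr Vdisj v1) in v2.
have gf_adj w y : w \in W1 -> y \in W2 -> adj w y -> adj (g w) (f y).
  move=> wW1 yW2 wy; have [/fintype.subsetP sD _ _] := hD w wW1.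
  have := gC w wW1; rewrite inE => /andP[_ /fintype.subsetP sfD].
  have /sfD : f y \in f @: D w by apply/imset_f/sD; rewrite inE yW2.
  by rewrite inE => /andP[].
(* [g] lands in [V1] and [f] in [V2], so disjointness makes the glued map injective. *)
pose h y := if y \in W1 then g y else f y.
apply: (@contains_copy_of_injection G H h) => [y z|y z yz]; rewrite /h.
  case: ifPn => y1; case: ifPn => z1.
  - exact: g_inj.
  - by move=> E; have := VN _ (gV1 y y1); rewrite E fV2 ?W2E // => /(_ isT).
  - by move=> E; have := VN _ (gV1 z z1); rewrite -E fV2 ?W2E // => /(_ isT).
  - by apply: f_inj; apply: W2E.
case: ifPn => y1; case: ifPn => z1.
- by have := W1ind y z y1 z1; rewrite yz.
- by apply: gf_adj => //; apply: W2E.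
- by rewrite adj_sym; apply: gf_adj; rewrite ?W2E // adj_sym.
- by have := W2ind y z (W2E y y1) (W2E z z1); rewrite yz.
Qed.
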